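(* Let $p > 2$ be a prime number. Then: (i) if $p = 3$ or $p \equiv 1 \pmod 4$, then $l(2\sqrt{p}) \equiv 2 \pmod 4$; (ii) if $p \equiv 3 \pmod 4$ and $p \neq 3$, then $l(2\sqrt{p}) \equiv 0 \pmod 4$.
   Context: For a real quadratic irrational number $\alpha$, $l(\alpha)$ denotes the minimal period length of its (eventually periodic) usual (regular) continued fraction expansion $a_0+\cfrac{1}{a_1+\cfrac{1}{a_2+\cdots}}$ with $a_0\in\mathbb{Z}$ and $a_i$ positive integers for $i\ge 1$. *)

(* Defs.v *)
From HB Require Import structures.
From mathcomp Require Import all_boot all_order all_algebra.
From mathcomp Require Import all_classical all_reals.
Set Implicit Arguments.
Unset Strict Implicit.
Unset Printing Implicit Defensive.
Import Order.TTheory GRing.Theory Num.Theory.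
Local Open Scope ring_scope.

Fixpoint cf_complete (R : realType) (x : R) (n : nat) : R :=
  if n is m.+1 then
    (cf_complete x m - (Num.floor (cf_complete x m))%:~R)^-1
  else x.

(* For irrational x this is the coefficient a_n of the regular continued
   fraction of x; for rational x the expansion stops, and the values after the
   last coefficient (all 0, since 0^-1 = 0) are meaningless. *)
Definition cf_coef (R : realType) (x : R) (n : nat) : int :=
  Num.floor (cf_complete x n).

Lemma cf_completeE (R : realType) (x : R) (n : nat) :
  cf_complete x n = (cf_coef x n)%:~R + (cf_complete x n.+1)^-1.
Proof. by rewrite /= invrK addrC subrK. Qed.

Lemma cf_coef_ge1 (R : realType) (x : R) (n : nat) :
  cf_complete x n \isn't a Num.int -> 1 <= cf_coef x n.+1.
Proof.
rewrite /cf_coef floor_ge_int /=; set y := cf_complete x n => yN.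
have y0 : 0 < y - (Num.floor y)%:~R.
  rewrite subr_gt0 lt_neqAle floor_le andbT.
  by apply: contraNneq yN => <-; exact: intr_int.
rewrite invf_ge1 // lerBlDl; apply: ltW.
by have := floorD1_gt y; rewrite intrD.
Qed.

Definition cf_period (R : realType) (x : R) (k : nat) : Prop :=
  (0 < k)%N /\
  exists N : nat, forall n : nat, (N <= n)%N -> cf_coef x (n + k) = cf_coef x n.

(* The least period. The default value, taken only when the expansion is not
   eventually periodic, is 1 so that neither [= 0 %[mod 4]] nor
   [= 2 %[mod 4]] can hold by default. *)
Definition cf_period_length (R : realType) (x : R) : nat :=
  xget 1%N [set k : nat |
    cf_period x k /\ forall j : nat, cf_period x j -> (k <= j)%N]%classic.

Lemma cf_period_lengthP (R : realType) (x : R) (k : nat) : cf_period x k ->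
  cf_period x (cf_period_length x) /\
  forall j : nat, cf_period x j -> (cf_period_length x <= j)%N.
Proof.
move=> xk; have ex : exists k, `[< cf_period x k >] by exists k; apply/asboolP.
rewrite /cf_period_length; case: xgetP => [_ -> //|none].
case: (ex_minnP ex) => m /asboolP xm min_m; case: (none m); split=> // j xj.
by apply: min_m; apply/asboolP.
Qed.

(* Main.v *)
(* Write [D = 4p] and let [xi_n = (P_n + sqrt D) / Q_n] be the complete
   quotients of [sqrt D], with [P_n^2 + Q_(n-1) Q_n = D].  The states
   [(P_n, Q_(n-1), Q_n)] stay in a finite set on which the continued fraction
   step is inverted by conjugation with the reversal
   [(P, Q', Q) |-> (P, Q, Q')]; hence they are purely periodic and palindromic.
   An odd [Q_n] is [(-1)^n] modulo 4.  As [Q_l = 1] at the period [l], [l] is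
   even, [l = 2m].  At the middle the step sends the state to its reversal,
   so [Q_m | 2 P_m], and [P_m^2 + Q_(m-1) Q_m = 4p] leaves only [Q_m = 4], or
   [Q_m = 3] with [p = 3].  If [Q_m = 4] then
   [Q_(m-1) = p - (P_m / 2)^2 = p] modulo 4, while
   [Q_(m-1) = (-1)^(m-1)] modulo 4: this gives the parity of [m]. *)

Require Import Defs.
From HB Require Import structures.
From mathcomp Require Import all_boot all_order all_algebra.
From mathcomp Require Import all_classical all_reals.
From mathcomp Require Import zify ring lra.
Set Implicit Arguments.
Unset Strict Implicit.
Unset Printing Implicit Defensive.
Import Order.TTheory GRing.Theory Num.Theory.
Local Open Scope ring_scope.

(** * Reduced states, the step and its reversal *)

(* A triple [(P, Q', Q)] stands for the complete quotient [(P + sqrt D) / Q],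
   where [Q'] is the previous denominator. *)
Definition qstate : Type := (nat * nat * nat)%type.

Definition quo (r : nat) (s : qstate) : nat :=
  let: (P, Q', Q) := s in ((P + r) %/ Q)%N.

Definition step (r : nat) (s : qstate) : qstate :=
  let: (P, Q', Q) := s in
  let a := quo r s in
  let P2 := (a * Q - P)%N in (P2, Q, (Q' + a * P - a * P2)%N).

Definition flip (s : qstate) : qstate := let: (P, Q', Q) := s in (P, Q, Q').

(* For [r = floor (sqrt D)] these are the usual inequalities [0 < P < sqrt D]
   and [sqrt D - P < Q, Q' < sqrt D + P]. *)
Definition reduced (D r : nat) (s : qstate) : Prop :=
  let: (P, Q', Q) := s in
  [/\ (P * P + Q' * Q = D)%N, (0 < P <= r)%N,
      (r < P + Q <= r + P + P)%N & (r < P + Q' <= r + P + P)%N].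

Lemma flip_reduced (D r : nat) (s : qstate) :
  reduced D r s -> reduced D r (flip s).
Proof. by case: s => [[P Q'] Q] [? ? ? ?]; split; rewrite // mulnC. Qed.

Lemma flipK : involutive flip.
Proof. by case=> [[P Q'] Q]. Qed.

Lemma quoP (D r P Q' Q : nat) : reduced D r (P, Q', Q) ->
  (0 < quo r (P, Q', Q) /\
    quo r (P, Q', Q) * Q <= P + r < (quo r (P, Q', Q)).+1 * Q)%N.
Proof.
case=> _ /andP[P0 Pr] /andP[Q1 Q2] _ /=.
have Q0 : (0 < Q)%N by lia.
rewrite divn_gt0 //; split; first lia.
by rewrite leq_divM ltn_ceil.
Qed.

(** Multiplying by [Q] shows that the last subtraction in [step] does not truncate:
    [(Q' + a * P) * Q = D + P * P2] and [a * P2 * Q = P * P2 + P2 * P2], where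
    [P2 * P2 <= r * r < D]. *)
Lemma stepP (D r P Q' Q : nat) (a := quo r (P, Q', Q)) :
  (r * r < D < r.+1 * r.+1)%N -> reduced D r (P, Q', Q) ->
  exists P2 Q2, [/\ step r (P, Q', Q) = (P2, Q, Q2), (P + P2 = a * Q)%N,
    (Q' + a * P = Q2 + a * P2)%N & reduced D r (P2, Q, Q2)].
Proof.
move=> /andP[rD Dr] sred.
have [] := quoP sred; rewrite /step -/a => a0 /andP[ale alt].
case: sred => eqD /andP[P0 Pr] /andP[Q1 Q2] /andP[Q'1 Q'2].
have QaQ : (Q <= a * Q)%N by rewrite leq_pmull.
rewrite mulSn in alt.
have [P2 eqP2] : exists P2, (P + P2 = a * Q)%N by exists (a * Q - P)%N; lia.
have -> : (a * Q - P = P2)%N by lia.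
have P2r : (0 < P2 <= r)%N by lia.
have eqL : ((Q' + a * P) * Q = D + P * P2)%N.
  by rewrite -eqD mulnDl mulnAC -eqP2; lia.
have eqR : (a * P2 * Q = P * P2 + P2 * P2)%N by rewrite mulnAC -eqP2; lia.
have P2D : (P2 * P2 <= r * r)%N by apply: leq_mul; lia.
have [R eqRR] : exists R, (Q' + a * P = R + a * P2)%N.
  exists (Q' + a * P - a * P2)%N; rewrite subnK //.
  by rewrite -(@leq_pmul2r Q) ?eqL ?eqR //; lia.
exists P2, R; have -> : (Q' + a * P - a * P2 = R)%N by lia.
have eqD2 : (P2 * P2 + Q * R = D)%N.
  by move: eqL; rewrite eqRR mulnDl eqR; lia.
split=> //; split=> //; first by apply/andP; split; nia.
by apply/andP; split; lia.
Qed.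

Lemma step_reduced (D r : nat) (s : qstate) : (r * r < D < r.+1 * r.+1)%N ->
  reduced D r s -> reduced D r (step r s).
Proof. by case: s => [[P Q'] Q] hr /(stepP hr)[P2 [Q2 [-> _ _ ?]]]. Qed.

(** The reversed state has the same partial quotient [a]: [P2 + r = a * Q + (r - P)] with
    [r - P < Q]. *)
Lemma flip_stepK (D r : nat) (s : qstate) : (r * r < D < r.+1 * r.+1)%N ->
  reduced D r s -> flip (step r (flip (step r s))) = s.
Proof.
case: s => [[P Q'] Q] hr sred.
have [P2 [Q2 [-> eP eQ s2red]]] := stepP hr sred.
have [P3 [Q3 [eqS eP3 eQ3 _]]] := stepP hr (flip_reduced s2red).
rewrite [flip (P2, _, _)]/= eqS.
case: sred => _ /andP[P0 Pr] /andP[Q1 _] _.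
case: s2red => _ /andP[P20 P2r] _ _.
have ea : quo r (P2, Q2, Q) = quo r (P, Q', Q).
  rewrite {1}/quo; have -> : (P2 + r = quo r (P, Q', Q) * Q + (r - P))%N by lia.
  by rewrite divnMDl ?divn_small; lia.
by rewrite ea in eP3 eQ3; congr (_, _, _); lia.
Qed.

Lemma step_inj (D r : nat) (s1 s2 : qstate) : (r * r < D < r.+1 * r.+1)%N ->
  reduced D r s1 -> reduced D r s2 -> step r s1 = step r s2 -> s1 = s2.
Proof.
by move=> hr /(flip_stepK hr) {2}<- /(flip_stepK hr) {2}<- ->.
Qed.

(** * The orbit of the first complete quotient *)

(** [sqrt D] itself is not reduced, so the orbit starts at [1 / (sqrt D - r) = (r + sqrt D) / (D - r
    * r)]. *)
Definition init (D r : nat) : qstate := (r, 1%N, (D - r * r)%N).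

Lemma init_reduced (D r : nat) : (0 < r)%N -> (r * r < D < r.+1 * r.+1)%N ->
  reduced D r (init D r).
Proof. by move=> r0 hr; split; rewrite ?r0 ?leqnn //; lia. Qed.

(** [flip (init D r)] stands for [r + sqrt D], which has the same fractional part as [sqrt D]. *)
Lemma step_flip_init (D r : nat) : (r * r < D)%N ->
  step r (flip (init D r)) = init D r.
Proof. by move=> hr; rewrite /= divn1; congr (_, _, _); lia. Qed.

Definition cf_state (D r n : nat) : qstate := iter n (step r) (init D r).

Lemma cf_state_reduced (D r n : nat) : (0 < r)%N ->
  (r * r < D < r.+1 * r.+1)%N ->
  reduced D r (cf_state D r n).
Proof.
move=> r0 hr; elim: n => [|n IHn]; first exact: init_reduced.
exact: step_reduced.
Qed.

Lemma cf_state_inj_add (D r i j k : nat) : (0 < r)%N ->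
  (r * r < D < r.+1 * r.+1)%N ->
  cf_state D r (k + i) = cf_state D r (k + j) ->
  cf_state D r i = cf_state D r j.
Proof.
move=> r0 hr; elim: k => // k IHk eqs; apply: IHk.
by apply: (step_inj hr) eqs; apply: cf_state_reduced.
Qed.

(** Entries of reduced states are at most [2 * r], so two states of the orbit coincide; injectivity
    of the step moves the coincidence back to index 0. *)
Lemma cf_state_periodic (D r : nat) : (0 < r)%N ->
  (r * r < D < r.+1 * r.+1)%N ->
  exists2 k, (0 < k)%N & cf_state D r k = init D r.
Proof.
move=> r0 hr.
pose T : finType := ('I_(r + r).+1 * 'I_(r + r).+1 * 'I_(r + r).+1)%type.
pose code (s : qstate) : T := (inord s.1.1, inord s.1.2, inord s.2).
have codeK s1 s2 : reduced D r s1 -> reduced D r s2 -> code s1 = code s2 ->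
    s1 = s2.
  case: s1 s2 => [[P1 Q'1] Q1] [[P2 Q'2] Q2] /= [_ /andP[? ?] /andP[? ?]].
  move=> /andP[? ?] [_ /andP[? ?] /andP[? ?] /andP[? ?]].
  move=> [/(congr1 val) + /(congr1 val) + /(congr1 val)].
  by rewrite /= !inordK; [move=> -> -> -> | lia..].
have : ~~ injectiveb (fun i : 'I_#|T|.+1 => code (cf_state D r i)).
  by apply/injectiveP => /leq_card; rewrite card_ord ltnn.
case/injectivePn => i [j ij /codeK eqs].
have {}eqs := eqs (cf_state_reduced _ r0 hr) (cf_state_reduced _ r0 hr).
wlog lij : i j ij eqs / (i < j)%N.
  move=> H; case: (ltngtP i j) => [||eij]; first exact: H.
    by apply: H; rewrite 1?eq_sym.
  by rewrite (val_inj eij) eqxx in ij.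
exists (j - i)%N; first by rewrite subn_gt0.
have -> : init D r = cf_state D r 0 by [].
by apply: (@cf_state_inj_add _ _ _ _ i r0 hr); rewrite addn0 subnKC // ltnW.
Qed.

(* Since [step (flip init) = init], the backward orbit of [init] is the flip of
   its forward orbit. *)
Lemma cf_state_flip (D r L n : nat) : (0 < r)%N ->
  (r * r < D < r.+1 * r.+1)%N ->
  cf_state D r L = init D r -> (n < L)%N ->
  flip (cf_state D r n) = cf_state D r (L - n.+1).
Proof.
move=> r0 hr eqL nL.
have back : iter n.+1 (step r) (flip (cf_state D r n)) = init D r.
  elim: n {nL} => [|n IHn]; first by case/andP: hr => /step_flip_init.
  rewrite iterSr -[RHS]IHn; congr (iter _ _ _).
  by apply: (can_inj flipK); rewrite flipK (flip_stepK hr) //;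
    exact: cf_state_reduced.
have inj k s1 s2 : reduced D r s1 -> reduced D r s2 ->
    iter k (step r) s1 = iter k (step r) s2 -> s1 = s2.
  elim: k s1 s2 => // k IHk s1 s2 red1 red2; rewrite !iterSr => /IHk eqs.
  by apply: (step_inj hr) => //; apply: eqs; apply: step_reduced.
apply: (inj n.+1); try exact: cf_state_reduced.
  by apply: flip_reduced; exact: cf_state_reduced.
by rewrite back -iterD subnKC.
Qed.

(** * Denominators modulo 4 *)

(* In the numbering [P_n, Q_n] of the complete quotients this says that an odd
   [Q_n] is [(-1)^n] modulo 4; the state of index [n] carries [Q_n] and
   [Q_(n+1)], since [init] is the state of index 0 and carries [Q_1]. *)
Definition signed_mod4 (n : nat) (s : qstate) : Prop :=
  let: (P, Q', Q) := s in
  if odd Q then (Q %% 4 = if odd n then 1 else 3)%N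
  else [/\ (4 %| Q)%N, ~~ odd P & (Q' %% 4 = if odd n then 3 else 1)%N].

Lemma mod4_cases (n : nat) : exists q,
  [\/ n = 4 * q, n = 4 * q + 1, n = 4 * q + 2 | n = 4 * q + 3]%N.
Proof.
exists (n %/ 4)%N; move: (divn_eq n 4) (ltn_pmod n (isT : 0 < 4)%N).
case: (n %% 4)%N => [|[|[|[|k]]]] // nE _.
- by constructor 1; lia.
- by constructor 2; lia.
- by constructor 3; lia.
- by constructor 4; lia.
Qed.

(** From odd [Q], [P2 * P2 + Q * Q2 = 4 * p] makes an odd [Q2] opposite to [Q] modulo 4 and an even
    [Q2] divisible by 4. From even [Q], [Q2 = Q' + 2 * a * P - a * a * Q] is [Q'] modulo 4. *)
Lemma cf_state_signed_mod4 (p r n : nat) : (0 < r)%N ->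
  (r * r < 4 * p < r.+1 * r.+1)%N -> signed_mod4 n (cf_state (4 * p) r n).
Proof.
move=> r0 hr; elim: n => [|n IHn].
  have [b] := mod4_cases r; rewrite /signed_mod4 /=.
  have [Q eqQ] : exists Q, (r * r + Q = 4 * p)%N.
    by exists (4 * p - r * r)%N; lia.
  rewrite (_ : 4 * p - r * r = Q)%N; last by lia.
  by case=> rE; rewrite rE in eqQ; (case: ifP => ?; last split); lia.
have := cf_state_reduced n r0 hr.
rewrite [cf_state _ _ n.+1]iterS -/(cf_state _ _ _).
case: (cf_state _ _ _) IHn => [[P Q'] Q] IHn sred.
have [P2 [Q2 [-> eP eQ s2red]]] := stepP hr sred.
case: sred s2red => eqD _ _ _ [eqD2 _ _ _].
move: (quo _ _) eP eQ => a eP eQ; move: IHn; rewrite /signed_mod4 oddS.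
case: ifP => [oddQ Q4 | evenQ [/dvdnP[c Qc] evenP Q'4]].
  have [b Qb] := mod4_cases Q2; have [c P2c] := mod4_cases P2.
  have [d Qd] := mod4_cases Q.
  case: (odd n) Q4 => /= Q4; case: Qd => Qd; rewrite Qd in oddQ Q4; try lia;
  case: P2c => P2c; case: Qb => Qb; rewrite Qb P2c Qd in eqD2 *;
  (case: ifP => ?; last split); lia.
have [b Pb] : exists b, P = (2 * b)%N by exists P./2; lia.
have eqQ2 : (Q' + 4 * (a * b) = Q2 + 4 * (a * a * c))%N.
  have : (Q' + a * P + a * P = Q2 + a * (a * Q))%N by rewrite -eP eQ; lia.
  by rewrite Pb Qc; lia.
have -> : odd Q2 by case: (odd n) Q'4 => /=; lia.
by case: (odd n) Q'4 => /=; lia.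
Qed.

(** The state of index [n] carries [Q_(n+1)], so the middle is [m = n + 1] and the parities of [n]
    are those of [m] reversed. *)
Lemma middle_sign (p a n P Q' Q : nat) : prime p -> (2 < p)%N ->
    (0 < P)%N -> (0 < Q')%N -> (P * P + Q' * Q = 4 * p)%N ->
    (a * Q = P + P)%N ->
    Q <> 1%N -> signed_mod4 n (P, Q', Q) ->
  ((p = 3 \/ p = 1 %[mod 4])%N -> ~~ odd n) /\
  ((p = 3 %[mod 4])%N -> (p <> 3)%N -> odd n).
Proof.
move=> pp p2 P0 Q'0 eqD eqa Q1; rewrite /signed_mod4.
case: ifP => [oddQ Q4 | evenQ [/dvdnP[k Qk] evenP Q'4]].
  have QP : (Q %| P)%N.
    have : (Q %| 2 * P)%N by apply/dvdnP; exists a; lia.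
    by rewrite Gauss_dvdr // coprimen2.
  have : (Q %| 4 * p)%N by rewrite -eqD dvdn_addr ?dvdn_mull.
  rewrite Gauss_dvdr; last first.
    by rewrite (_ : 4 = 2 ^ 2)%N // coprime_pexpr // coprimen2.
  move/eqP: Q1 => Q1 /(prime_nt_dvdP pp Q1) Qp.
  have pP : (p <= P)%N by rewrite -Qp dvdn_leq.
  have p3 : p = 3%N.
    have : (p * p < 4 * p)%N.
      apply: leq_ltn_trans (leq_mul pP pP) _.
      by rewrite -eqD -[ltnLHS]addn0 ltn_add2l muln_gt0 Q'0 Qp prime_gt0.
    by rewrite ltn_pmul2r ?prime_gt0 //; lia.
  by rewrite Qp p3 in Q4 *; split=> // _; case: (odd n) Q4.
have Pak : P = (2 * (a * k))%N by lia.
have kp : (k * (a * a * k + Q') = p)%N by rewrite Pak Qk in eqD; lia.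
have a0 : (0 < a)%N by case: (a) Pak P0; lia.
have k1 : k = 1%N.
  apply/eqP; apply/negPn/negP => k1.
  have : (k %| p)%N by rewrite -kp dvdn_mulr.
  move/(prime_nt_dvdP pp k1) => eqk; move/eqP: kp.
  rewrite eqk -[eqbRHS]muln1 eqn_pmul2l ?prime_gt0 //.
  have : (0 < a * a * p)%N by rewrite !muln_gt0 a0 prime_gt0.
  by lia.
rewrite {}k1 in kp Pak Qk *.
(* Now [a * a + Q' = p] with [p] and [Q'] odd, so [a] is even and [Q' = p] modulo 4; [a > 0] then
   excludes [p = 3]. *)
have [c] := mod4_cases a; have [d Qd] := mod4_cases Q'.
have odp : odd p by case: (even_prime pp) p2 => [->|].
by case=> ac; rewrite ac in a0 kp; case: Qd => Qd; rewrite Qd in kp Q'4;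
  split; case: (odd n) Q'4; lia.
Qed.

(** * Real complete quotients of the square root, and its periods *)

Definition quotient (R : realType) (x : R) (s : qstate) : R :=
  let: (P, Q', Q) := s in (P%:R + x) / Q%:R.

Lemma sqrt_bounds (R : realType) (x : R) (D r : nat) : 0 <= x ->
  x * x = D%:R -> (r * r < D < r.+1 * r.+1)%N -> r%:R < x < r.+1%:R.
Proof.
move=> x0 xD /andP[]; rewrite -!(ltr_nat R) !natrM -xD -!expr2.
by rewrite !ltr_pXn2r ?nnegrE ?ler0n // => -> ->.
Qed.

Section RealQuotients.

Variables (R : realType) (x : R) (D r : nat).
Hypotheses (r0 : (0 < r)%N) (hr : (r * r < D < r.+1 * r.+1)%N).
Hypotheses (x0 : 0 <= x) (xD : x * x = D%:R).

(** [r] can replace [x] by integrality: [a * Q <= P + r], [P + r + 1 <= (a + 1) * Q] and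
    [r < x < r + 1]. *)
Lemma floor_quotient (s : qstate) : reduced D r s ->
  Num.floor (quotient x s) = (quo r s)%:Z.
Proof.
case: s => [[P Q'] Q] sred; have [_ /andP[ale alt]] := quoP sred.
move: (quo _ _) ale alt => a ale alt.
have /andP[rx xr] := sqrt_bounds x0 xD hr.
have Q0 : 0 < Q%:R :> R.
  by case: sred => _ /andP[? ?] /andP[? ?] _; rewrite ltr0n; lia.
apply: floor_def; rewrite /quotient ler_pdivlMr // ltr_pdivrMr //.
rewrite -[_ + 1]/((a%:Z + 1%:Z)) -PoszD addn1 -!pmulrn.
move: ale alt; rewrite -ltnS => ale alt.
have : (a * Q)%:R <= (P + r)%:R :> R by rewrite ler_nat.
have : (P + r).+1%:R <= (a.+1 * Q)%:R :> R by rewrite ler_nat.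
rewrite !natrM -addnS !natrD => alt' ale'.
by apply/andP; split; lra.
Qed.

(** Rationalisation: [(x - P2) * (x + P2) = Q * Q2]. *)
Lemma quotient_step (s : qstate) : reduced D r s ->
  (quotient x s - (quo r s)%:R)^-1 = quotient x (step r s).
Proof.
case: s => [[P Q'] Q] sred; have [P2 [Q2 [-> eP eQ s2red]]] := stepP hr sred.
have /andP[rx xr] := sqrt_bounds x0 xD hr.
case: sred => [_ /andP[P0 Pr] /andP[PQ _] _].
case: s2red => [eqD2 /andP[P20 P2r] _ /andP[PQ2 _]].
have Q0 : Q%:R != 0 :> R by rewrite pnatr_eq0; lia.
have xP2 : x - P2%:R != 0.
  have : P2%:R <= r%:R :> R by rewrite ler_nat.
  by move=> h; rewrite gt_eqF //; lra.
have Q20 : Q2%:R != 0 :> R.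
  apply: contraTneq isT => Q20.
  have : (Q2 == 0)%N by rewrite -(pnatr_eq0 R) Q20.
  by move=> Q2'; case/andP: hr; nia.
have eqPR : P%:R + P2%:R = (quo r (P, Q', Q))%:R * Q%:R :> R.
  by rewrite -natrD eP natrM.
have eqDR : P2%:R * P2%:R + Q%:R * Q2%:R = x * x :> R.
  by rewrite xD -!natrM -natrD eqD2.
rewrite /quotient; apply: (mulfI xP2).
have -> : (P%:R + x) / Q%:R - (quo r (P, Q', Q))%:R = (x - P2%:R) / Q%:R.
  by apply: (mulIf Q0); rewrite mulrBl -eqPR !divfK //; ring.
rewrite invf_div mulrCA divff // mulr1; apply: (mulIf Q20).
by rewrite mulrA divfK //; move: eqDR; lra.
Qed.

Lemma cf_complete_state (n : nat) :
  cf_complete x n.+1 = quotient x (cf_state D r n) /\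
  cf_coef x n.+1 = (quo r (cf_state D r n))%:Z.
Proof.
suff eqn : cf_complete x n.+1 = quotient x (cf_state D r n).
  by rewrite /cf_coef eqn floor_quotient //; exact: cf_state_reduced.
elim: n => [|n IHn].
  have /andP[rx xr] := sqrt_bounds x0 xD hr.
  have -> : cf_complete x 1 = (x - r%:R)^-1.
    rewrite /= (floor_def (m := r%:Z)) //.
    by rewrite -[_ + 1]/((r%:Z + 1%:Z)) -PoszD addn1 -!pmulrn ltW.
  rewrite /quotient /=; have /andP[rD _] := hr.
  have -> : (D - r * r)%:R = (x - r%:R) * (r%:R + x).
    by rewrite natrB ?natrM -?xD; [ring | exact: ltnW].
  rewrite invfM mulrCA divff ?mulr1 //.
  by rewrite gt_eqF // ltr_wpDr ?ltr0n.
have red := cf_state_reduced n r0 hr.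
rewrite [cf_state _ _ _]iterS -/(cf_state _ _ _) -(quotient_step red) -IHn /=.
by rewrite -/(cf_complete x n.+1) IHn floor_quotient.
Qed.

Lemma quotient_gt1 (s : qstate) : reduced D r s -> 1 < quotient x s.
Proof.
case: s => [[P Q'] Q] [_ /andP[P0 Pr] /andP[PQ QP] _].
have /andP[rx xr] := sqrt_bounds x0 xD hr.
rewrite /quotient ltr_pdivlMr ?ltr0n; last by lia.
have : Q%:R <= (P + r)%:R :> R by rewrite ler_nat; lia.
rewrite !natrD mul1r; lra.
Qed.

(** Different denominators would make [x] rational, hence [D] a square, which the bounds on [D]
    forbid. *)
Lemma quotient_inj (s1 s2 : qstate) : reduced D r s1 -> reduced D r s2 ->
  quotient x s1 = quotient x s2 -> s1 = s2.
Proof.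
wlog le21 : s1 s2 / (s2.2 <= s1.2)%N.
  move=> H red1 red2 eqs; case/orP: (leq_total s1.2 s2.2) => le; last exact: H.
  by apply/esym; apply: H.
case: s1 s2 le21 => [[P1 Q1'] Q1] [[P2 Q2'] Q2] /= le21.
case=> eq1 /andP[P10 P1r] /andP[PQ1 _] _ [eq2 /andP[P20 P2r] /andP[PQ2 _] _].
have Q10 : Q1%:R != 0 :> R by rewrite pnatr_eq0; lia.
have Q20 : Q2%:R != 0 :> R by rewrite pnatr_eq0; lia.
move/eqP; rewrite eqr_div // => /eqP eqx.
have eqk : x * (Q1 - Q2)%:R = (P1 * Q2)%:R - (P2 * Q1)%:R.
  by rewrite natrB // !natrM; move: eqx; lra.
have le12 : (P2 * Q1 <= P1 * Q2)%N.
  by rewrite -(ler_nat R) -subr_ge0 -eqk mulr_ge0.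
have eqQ : Q1 = Q2.
  apply/eqP; rewrite eqn_leq le21 andbT -subn_eq0 -leqn0 leqNgt; apply/negP.
  move: eqk; rewrite -natrB //; move: (Q1 - Q2)%N (P1 * Q2 - _)%N => k v eqk k0.
  have eqN : (D * k ^ 2 = v ^ 2)%N.
    apply/eqP; rewrite -(eqr_nat R) natrM !natrX -xD -eqk.
    by apply/eqP; ring.
  have : (k %| v)%N by rewrite -(@dvdn_pexp2r _ _ 2) // -eqN dvdn_mull.
  case/dvdnP=> w vE; move/eqP: eqN.
  rewrite vE expnMn eqn_pmul2r ?expn_gt0 ?k0 // => /eqP Dw.
  by case/andP: hr; rewrite Dw !mulnn !ltn_exp2r //; lia.
rewrite {}eqQ in eq1 eqx Q10 *.
have eqP : P1 = P2.
  apply/eqP; rewrite -(eqr_nat R); apply/eqP.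
  by apply: (addIr x); apply: (mulIf Q20).
rewrite {}eqP in eq1 *; congr (_, _, _).
have Q2p : (0 < Q2)%N by lia.
by apply/eqP; rewrite -(eqn_pmul2r Q2p); apply/eqP; lia.
Qed.

(* Two complete quotients with the same integer part satisfy
   [y - z = - (y' - z') / (y' * z')], so [`|y_n - y_(n + k)|] is strictly
   increasing in [n] wherever it is not zero, whereas it is periodic. *)
Lemma cf_periodP (k : nat) :
  cf_period x k <-> (0 < k)%N /\ cf_state D r k = init D r.
Proof.
split=> [[k0 [N perN]] | [k0 eqk]]; last first.
  (* Index 0 is skipped: [cf_coef x 0] is the floor of [x], while the states describe the
     coefficients from index 1 on. *)
  split=> //; exists 1%N => -[//|n] _; rewrite addSn.
  by rewrite !(cf_complete_state _).2 /cf_state iterD -/(cf_state D r k) eqk.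
split=> //; pose y n := quotient x (cf_state D r n).
pose d n := `|y n - y (n + k)%N|.
have y1 n : 1 < y n by apply: quotient_gt1; exact: cf_state_reduced.
have yS n : y n = (quo r (cf_state D r n))%:R + (y n.+1)^-1.
  by rewrite /y [cf_state _ _ n.+1]iterS -quotient_step ?invrK ?subrKC //;
    exact: cf_state_reduced.
have dS n : (N <= n)%N -> d n.+1 = d n * (y n.+1 * y (n + k).+1).
  move=> leNn; rewrite /d addSn (yS n) (yS (n + k)%N).
  have -> : quo r (cf_state D r (n + k)) = quo r (cf_state D r n).
    have := perN n.+1 (leqW leNn).
    by rewrite addSn !(cf_complete_state _).2 => -[].
  have yn0 : y n.+1 != 0 by rewrite gt_eqF // (lt_trans ltr01).
  have yk0 : y (n + k).+1 != 0 by rewrite gt_eqF // (lt_trans ltr01).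
  have p0 : 0 <= y n.+1 * y (n + k).+1.
    by rewrite mulr_ge0 // ltW // (lt_trans ltr01).
  rewrite -[X in _ = _ * X](ger0_norm p0) -normrM distrC; congr `|_|.
  by field; rewrite yn0 yk0.
have ygt n : 1 < y n.+1 * y (n + k).+1.
  by rewrite -[ltLHS]mulr1 ltr_pM // ?ltr01.
have dle n : (N <= n)%N -> d n <= d n.+1.
  by move=> leNn; rewrite dS // ler_peMr ?normr_ge0 // ltW.
have [L L0 perL] := cf_state_periodic r0 hr.
have dL : d (L + N)%N = d N.
  have per n : y (n + L)%N = y n.
    by rewrite /y /cf_state iterD -/(cf_state D r L) perL.
  by rewrite /d addnC per addnAC per.
have dmono m : d N.+1 <= d (m.+1 + N)%N.
  elim: m => // m IHm; apply: le_trans IHm _; rewrite (addSn m.+1).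
  by apply: dle; rewrite leq_addl.
have d0 : d N = 0.
  have := dmono L.-1; rewrite prednK // dL dS // => le.
  apply/eqP; apply: contraTT le => dN; rewrite -ltNge.
  by rewrite ltr_pMr // lt_neqAle eq_sym dN normr_ge0.
have /(quotient_inj (cf_state_reduced _ r0 hr) (cf_state_reduced _ r0 hr)) eqN :
  quotient x (cf_state D r N) = quotient x (cf_state D r (N + k)).
  by apply/eqP; rewrite -subr_eq0 -normr_eq0; apply/eqP.
have := @cf_state_inj_add D r 0 k N r0 hr; rewrite addn0 => <- //.
Qed.

End RealQuotients.

(** * Parity of the half period *)

Lemma half_period_parity (p r L : nat) : prime p -> (2 < p)%N -> (0 < r)%N ->
    (r * r < 4 * p < r.+1 * r.+1)%N ->
    (0 < L)%N -> cf_state (4 * p) r L = init (4 * p) r ->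
    (forall j, (0 < j)%N -> cf_state (4 * p) r j = init (4 * p) r ->
      (L <= j)%N) ->
  exists2 n, L = n.+1.*2 &
    ((p = 3 \/ p = 1 %[mod 4])%N -> ~~ odd n) /\
    ((p = 3 %[mod 4])%N -> (p <> 3)%N -> odd n).
Proof.
move=> pp p2 r0 hr L0 perL minL.
(* The state of index [L - 1] is [flip (init (4 * p) r)], whose last entry is 1; its sign forces [L]
   to be even. *)
have evenL : ~~ odd L.
  apply/negP => oddL; have := cf_state_signed_mod4 L.-1 r0 hr.
  have := cf_state_flip r0 hr perL L0; rewrite subn1 => <-.
  by rewrite /signed_mod4 /=; case: (L) L0 oddL => //= l _ /negPf ->.
have [n Ln] : exists n, L = n.+1.*2.
  by exists L./2.-1; rewrite prednK; lia.
exists n => //; have nL : (n.+1 < L)%N by lia.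
have := cf_state_flip r0 hr perL (ltnW nL).
have -> : (L - n.+1)%N = n.+1 by lia.
have := cf_state_signed_mod4 n r0 hr; have := cf_state_reduced n r0 hr.
have notinit : cf_state (4 * p) r n.+1 <> init (4 * p) r.
  by move/(minL n.+1 (ltn0Sn n)); rewrite leqNgt nL.
move: notinit; rewrite [cf_state _ _ n.+1]iterS -/(cf_state _ _ _).
case: (cf_state _ _ _) => [[P Q'] Q] notinit sred sgn eqf.
have [P2 [Q2 [eqs eP _ _]]] := stepP hr sred.
have PP2 : P = P2 by move: eqf; rewrite eqs /=; case.
rewrite -PP2 in eP.
case: sred => eqD /andP[P0 Pr] /andP[PQ _] /andP[PQ' QP'].
apply: (middle_sign pp p2 P0 _ eqD (esym eP) _ sgn); first by lia.
(* [Q = 1] would make the state [flip (init (4 * p) r)] and its successor [init (4 * p) r], against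
   the minimality of [L]. *)
move=> Q1; apply: notinit; have Pr' : P = r by lia.
rewrite -(step_flip_init (D := 4 * p) (r := r)); last by case/andP: hr.
by rewrite Q1 Pr'; congr (step _ (_, _, _)); lia.
Qed.

Theorem corollary3p11 (R : realType) (p : nat) (hp : prime p) (hp2 : (2 < p)%N) :
  ((p = 3 \/ p = 1 %[mod 4])%N ->
     (cf_period_length (2 * Num.sqrt (p%:R : R))%R = 2 %[mod 4])%N)
  /\
  ((p = 3 %[mod 4])%N -> (p <> 3)%N ->
     (cf_period_length (2 * Num.sqrt (p%:R : R))%R = 0 %[mod 4])%N).
Proof.
set x := _ * _.
have x0 : 0 <= x by rewrite mulr_ge0 ?sqrtr_ge0.
have xD : x * x = (4 * p)%:R.
  by rewrite /x mulrACA -[X in _ * X]expr2 sqr_sqrtr ?ler0n // -natrM -natrM.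
have [r hr] : exists r, (r * r < 4 * p < r.+1 * r.+1)%N.
  exists (Num.truncn x); have /andP[] := truncn_itv x0.
  move: (Num.truncn x) => r rx xr; apply/andP; split; last first.
    by rewrite -(ltr_nat R) -xD natrM -!expr2 ltr_pXn2r ?nnegrE ?ler0n.
  rewrite ltn_neqAle -(ler_nat R) -xD natrM -!expr2.
  rewrite ler_pXn2r ?nnegrE ?ler0n // rx andbT.
  (* [r * r = 4 * p] would give [r = w * p] and [p * w ^ 2 = 2 ^ 2], so [p] would divide 2. *)
  apply: contraTneq hp2 => eqr.
  have : (p %| r ^ 2)%N by rewrite -mulnn eqr dvdn_mull.
  rewrite Euclid_dvdX // andbT => /dvdnP[w rE]; rewrite -leqNgt.
  have : (p * (p * w ^ 2) == p * 2 ^ 2)%N.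
    by apply/eqP; move: eqr; rewrite rE; lia.
  rewrite eqn_pmul2l ?prime_gt0 // => /eqP eq4.
  have : (p %| 2 ^ 2)%N by rewrite -eq4 dvdn_mulr.
  by rewrite Euclid_dvdX // andbT => /dvdn_leq->.
have r0 : (0 < r)%N by case: (r) hr => //; lia.
have perP := cf_periodP r0 hr x0 xD.
have [L L0 perL] := cf_state_periodic r0 hr.
have [/perP[l0 perl] minl] := cf_period_lengthP (proj2 (perP L) (conj L0 perL)).
have [|n eqn [par1 par2]] := half_period_parity hp hp2 r0 hr l0 perl.
  by move=> j j0 perj; apply: minl; apply/perP.
by rewrite eqn; split=> [/par1 | h1 h2]; [|have := par2 h1 h2]; lia.
Qed.
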